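(* Let $\mathbb{F}_q$ be a finite field and let $a,b\in M_n(\mathbb{F}_q)$ be not both $0$. Then $$|K_n(a,b)|\le 2q^{n^2-n+1}.$$
   Context: $\mathbb{F}_q$ is a finite field of characteristic $p$. The additive character $\varphi:\mathbb{F}_q\to\mathbb{C}^*$ is $\varphi(x)=\exp(2\pi i\,\mathrm{Tr}_{\mathbb{F}_q/\mathbb{F}_p}(x)/p)$, and $\psi=\varphi\circ\mathrm{tr}$ on $M_n(\mathbb{F}_q)$, where $\mathrm{tr}$ is the matrix trace. For $a,b\in M_n(\mathbb{F}_q)$, $K_n(a,b)=\sum_{x\in \mathrm{GL}_n(\mathbb{F}_q)}\psi(ax+bx^{-1})$. *)

(* Defs.v *)
From HB Require Import structures.
From mathcomp Require Import all_boot all_order all_algebra all_fingroup all_field.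
From mathcomp Require Import complex.
From mathcomp Require Import reals sequences exp trigo.

Set Implicit Arguments.
Unset Strict Implicit.
Unset Printing Implicit Defensive.

Import Order.TTheory GRing.Theory Num.Theory.

Local Open Scope ring_scope.

Definition cexp (R : realType) (z : R[i]) : R[i] :=
  Complex (expR (complex.Re z) * cos (complex.Im z))
          (expR (complex.Re z) * sin (complex.Im z)).

Section Kloosterman.

Variables (R : realType) (F : finFieldType) (p : nat).
Hypothesis charFp : p \in [pchar F].

(* F carrying its structure of (splitting field) extension of 'F_p *)
Local Notation L := (pPrimeCharType charFp).

(* galTrace takes its values in L; this is the element of 'F_p that the
   structure map k |-> k%:A sends to it (see trFpP; the default is unused). *)
Definition trFp (x : F) : 'F_p :=
  odflt 0 [pick k : 'F_p | k%:A == galTrace 1 {:L} (x : L)].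

Lemma trFpP (x : F) : (trFp x)%:A = galTrace 1 {:L} (x : L).
Proof.
rewrite /trFp; case: pickP => [k /eqP //|noK].
have gal : galois 1 {:L} by exact: finField_galois (sub1v _).
have /vlineP[k defk] := mem_galTrace gal (memvf (x : L)).
by have := noK k; rewrite defk eqxx.
Qed.

(* trFp x enters through its representative in {0, ..., p - 1} *)
Definition addchar (x : F) : R[i] :=
  cexp (Complex 0 (2 * pi * (trFp x : nat)%:R / p%:R)).

Definition mxaddchar (n : nat) (x : 'M[F]_n) : R[i] := addchar (\tr x).

Definition kloosterman (n : nat) (a b : 'M[F]_n) : R[i] :=
  \sum_(x : 'M[F]_n | x \in unitmx) mxaddchar (a *m x + b *m invmx x).

End Kloosterman.

(* Main.v *)
Require Import Defs.
From mathcomp Require Import all_boot all_order all_algebra all_fingroup all_field.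
From mathcomp Require Import complex.
From mathcomp Require Import reals sequences exp trigo.

Set Implicit Arguments.
Unset Strict Implicit.
Unset Printing Implicit Defensive.

Import Order.TTheory GRing.Theory Num.Theory.

Local Open Scope ring_scope.

(** Exchanging [a] and [b] does not change the sum (substitute [x^-1] for [x]),
so one may assume [a != 0] and choose a row vector [l] with [l a != 0].

The Kloosterman phase is nonlinear in [x] because of [x^-1], but it becomes
linear along suitable unipotent directions.  If [v] is a column with
[l v = 0], then [v l] has square zero, so [1 + v l] has inverse [1 - v l], and
replacing [x] by [x (1 + v l)] multiplies the summand of [x] by
[chi ((l a x - l x^-1 b) v)].  Averaging over all [v] in the hyperplane
[l v = 0] kills every [x] for which [l a x - l x^-1 b] is not a multiple of
[l] (orthogonality, [sum_char_rV]).  Since each summand has norm [1], the sum is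
bounded by the number of the surviving, resonant [x]
([norm_sum_unitmx_le]).

It remains to count the invertible [x] with [l a x - l x^-1 b = c l] for some
scalar [c] ([card_resonant_le]).  Put [mu = l x^-1], so that [mu x = l] and
[l a x = mu b + c l].
- If [mu] and [l a] are independent, then, once [mu] and [c] are given
  ([q^(n+1)] choices), the images under [x] of two independent vectors are
  prescribed, which leaves at most [q^(n^2-2n)] matrices.
- Otherwise [l a = d mu], hence [l a x = d l] for one of [q] scalars [d]; here
  the image of the one nonzero vector [l a] is prescribed, which leaves at
  most [q^(n^2-n)] matrices.
Each case contributes at most [q^(n^2-n+1)], whence the factor [2]. *)

(** * Counting the resonant matrices *)

(** If [D] is a right inverse of [B], adding [D y] to a solution [x] of [B x = C]
turns it into a solution of [B x = C + y]; hence translates of the solution set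
by the [D y] are pairwise disjoint. *)
Lemma card_mulmx_eq_le (F : finFieldType) (k n m : nat)
    (B : 'M[F]_(k, n)) (C : 'M[F]_(k, m)) :
  row_free B ->
  (#|[set x : 'M[F]_(n, m) | B *m x == C]| * #|F| ^ (k * m) <=
   #|F| ^ (n * m))%N.
Proof.
case/row_freeP => D BD1; rewrite -!card_mx -cardsT -cardsX.
pose f (xy : 'M[F]_(n, m) * 'M[F]_(k, m)) := xy.1 + D *m xy.2.
rewrite -(card_in_imset (f := f)); first exact: max_card.
move=> [x y] [x' y']; rewrite !inE !andbT /= => /eqP Bx /eqP Bx' fE.
have yy' : y = y'.
  (* Applying [B] recovers [y], as [B (x + D y) = C + y]. *)
  have := congr1 (mulmx B) fE.
  by rewrite /f /= !mulmxDr !mulmxA BD1 !mul1mx Bx Bx' => /addrI.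
by move: fE; rewrite /f /= yy' => /addIr ->.
Qed.

Lemma card_bigcup_le (I T : finType) (P : pred I) (S : I -> {set T}) :
  (#|\bigcup_(i | P i) S i| <= \sum_(i | P i) #|S i|)%N.
Proof.
elim/big_rec2: _ => [|i m A _ leAm]; first by rewrite cards0.
by apply: leq_trans (leq_card_setU _ _) _; rewrite leq_add2l.
Qed.

Lemma card_bigcup_mul_le (I T : finType) (P : pred I) (S : I -> {set T}) c M :
  (forall i, P i -> #|S i| * c <= M)%N ->
  (#|\bigcup_(i | P i) S i| * c <= #|I| * M)%N.
Proof.
move=> leM; apply: leq_trans (_ : (\sum_(i | P i) M <= _)%N); last first.
  by rewrite sum_nat_const leq_mul2r max_card orbT.
apply: leq_trans (leq_mul (card_bigcup_le P S) (leqnn c)) _.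
by rewrite big_distrl /=; apply: leq_sum.
Qed.

Lemma row_free_col_mx2 (F : fieldType) (n : nat) (u v : 'rV[F]_n) :
  u != 0 -> ~~ (v <= u)%MS -> row_free (col_mx u v).
Proof.
move=> u0 vu; apply: inj_row_free => w; rewrite -[w]hsubmxK mul_row_col.
set s := lsubmx w; set t := rsubmx w.
rewrite [s]mx11_scalar [t]mx11_scalar !mul_scalar_mx => e.
have t0 : t 0 0 = 0.
  apply: contraNeq vu => t0; apply/sub_rVP; exists (- (t 0 0)^-1 * s 0 0).
  apply: (scalerI t0); rewrite scalerA mulrA mulrN mulfV // mulN1r scaleNr.
  by apply/eqP; rewrite -addr_eq0 addrC e.
move: e; rewrite t0 scale0r addr0 => /eqP.
by rewrite scaler_eq0 (negPf u0) orbF => /eqP ->; rewrite raddf0 row_mx0.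
Qed.

(** The indices of the summands that survive averaging over the unipotent
matrices [1 + v l] with [l v = 0]; see [norm_sum_unitmx_le]. *)
Definition resonant (F : finFieldType) (n : nat) (a b : 'M[F]_n)
    (l : 'rV[F]_n) : {set 'M[F]_n} :=
  [set x in unitmx | (l *m a *m x - l *m invmx x *m b <= l)%MS].

(** The matrices are split according to whether [mu = l x^-1] is independent from
[l a].  Both parts are covered by families of linear systems in [x]: systems
[l a x = d l] indexed by [d] in the dependent case, and systems on the rows
[mu] and [l a] indexed by [(mu, c)] in the independent one. *)
Lemma card_resonant_le (F : finFieldType) (n : nat) (a b : 'M[F]_n)
    (l : 'rV[F]_n) :
  l *m a != 0 -> (#|resonant a b l| <= 2 * #|F| ^ (n ^ 2 - n + 1))%N.
Proof.
move=> la0; set q := #|F|.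
have q0 : (0 < q)%N by apply/card_gt0P; exists 0.
have l0 : l != 0 by apply: contraNneq la0 => ->; rewrite mul0mx.
pose dep := \bigcup_(d : F | true) [set x : 'M[F]_n | l *m a *m x == d *: l].
pose indep := \bigcup_(mc : 'rV[F]_n * F | row_free (col_mx mc.1 (l *m a)))
  [set x : 'M[F]_n |
    col_mx mc.1 (l *m a) *m x == col_mx l (mc.1 *m b + mc.2 *: l)].
have cover : resonant a b l \subset dep :|: indep.
  apply/subsetP => x; rewrite !inE => /andP[ux /sub_rVP[c cE]].
  set mu := l *m invmx x.
  have mux : mu *m x = l by rewrite mulmxKV.
  have [/sub_rVP[d dE]|nsub] := boolP (l *m a <= mu)%MS.
    apply/orP; left; apply/bigcupP; exists d => //.
    by rewrite inE dE -scalemxAl mux.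
  apply/orP; right; apply/bigcupP; exists (mu, c) => /=.
    apply: row_free_col_mx2 => //; apply: contraNneq l0 => mu0.
    by rewrite -mux mu0 mul0mx.
  by rewrite inE mul_col_mx mux -cE addrC subrK.
have depP : (#|dep| * q ^ n <= q * q ^ (n ^ 2))%N.
  apply: card_bigcup_mul_le => d _; rewrite -[n in (q ^ n)%N]mul1n -mulnn.
  apply: card_mulmx_eq_le; apply: inj_row_free => v.
  rewrite [v]mx11_scalar mul_scalar_mx => /eqP; rewrite scaler_eq0 (negPf la0).
  by rewrite orbF => /eqP ->; rewrite raddf0.
have indepP : (#|indep| * q ^ (2 * n) <= q ^ n * q * q ^ (n ^ 2))%N.
  have -> : (q ^ n * q = #|{: 'rV[F]_n * F}|)%N.
    by rewrite card_prod card_mx mul1n.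
  apply: card_bigcup_mul_le => mc fr.
  by rewrite -mulnn; apply: card_mulmx_eq_le.
have lenn : (n <= n ^ 2)%N.
  by rewrite -mulnn; case: (n) => // k; rewrite leq_pmulr.
(* The counts are compared after multiplication by [q ^ n], which avoids the
   truncated exponents [n ^ 2 - n] and [n ^ 2 - 2 * n]. *)
have splitq : (q ^ (n ^ 2 - n + 1) * q ^ n = q * q ^ (n ^ 2))%N.
  by rewrite -expnD addnAC subnK // addn1 expnS.
have qn0 : (0 < q ^ n)%N by rewrite expn_gt0 q0.
apply: leq_trans (subset_leq_card cover) _.
apply: leq_trans (leq_card_setU _ _) _.
rewrite mul2n -addnn leq_add // -(leq_pmul2r qn0) splitq //.
rewrite -(leq_pmul2r qn0) -mulnA -expnD addnn -mul2n.
by rewrite mulnC [leqRHS]mulnC mulnA [(_ * #|_|)%N]mulnC.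
Qed.

(** * Averaging over unipotent translations *)

(** Orthogonality: some translation [u0] multiplies the summands by a constant
[chi t] different from [1], so the sum equals [chi t] times itself. *)
Lemma sum_char_rV (C : numDomainType) (F : finFieldType) (chi : F -> C)
    (n : nat) (w : 'rV[F]_n) :
  {morph chi : x y / x + y >-> x * y} -> (exists t, chi t != 1) ->
  w != 0 -> \sum_(u : 'cV[F]_n) chi ((w *m u) 0 0) = 0.
Proof.
move=> chiD [t chit] /rV0Pn[i wi]; set S := (LHS).
pose u0 : 'cV[F]_n := (t / w 0 i) *: delta_mx i 0.
have wu0 : (w *m u0) 0 0 = t.
  by rewrite -scalemxAr -colE !mxE mulfVK.
have : S = chi t * S.
  rewrite {1}/S (reindex_inj (addrI u0)) /= mulr_sumr; apply: eq_bigr => u _.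
  by rewrite mulmxDr mxE wu0 chiD.
move/eqP; rewrite eq_sym -subr_eq0 -{2}[S]mul1r -mulrBl mulf_eq0 subr_eq0.
by rewrite (negPf chit) => /eqP.
Qed.

(** For [l v = 0], translating [x] by [1 + v l] multiplies the summand of [x] by
[chi ((l a x - l x^-1 b) v)].  Averaging over these [v], the sum over [v]
vanishes outside [resonant a b l] and has norm at most the number of [v] on it.
*)
Lemma norm_sum_unitmx_le (C : numDomainType) (F : finFieldType) (chi : F -> C)
    (n : nat) (a b : 'M[F]_n) (l : 'rV[F]_n) :
  {morph chi : x y / x + y >-> x * y} -> (forall t, `|chi t| = 1) ->
  (exists t, chi t != 1) ->
  `|\sum_(x in unitmx) chi (\tr (a *m x + b *m invmx x))|
    <= #|resonant a b l|%:R.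
Proof.
move=> chiD chi1 chiN; pose f x := chi (\tr (a *m x + b *m invmx x)).
pose w x := l *m a *m x - l *m invmx x *m b.
set S := \sum_(x in _) _.
(* The columns [v] with [l v = 0] are parametrised, with repetitions, as
   [v = K u]; this lets the average run over all of ['cV_n]. *)
have [K lK wK] : exists2 K : 'M_n, l *m K = 0 &
    forall v : 'rV_n, (v <= l)%MS = (v *m K == 0).
  by exists (cokermx l) => [|v]; rewrite ?mulmx_coker ?submxE.
have shift (u : 'cV[F]_n) :
    S = \sum_(x in unitmx) f x * chi ((w x *m K *m u) 0 0).
  pose N := K *m u *m l; pose h := 1%:M + N; pose h' := 1%:M - N.
  have NN : N *m N = 0.
    by rewrite /N -(mulmxA (K *m u)) !(mulmxA l) lK !mul0mx mulmx0.
  have hh' : h *m h' = 1%:M.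
    by rewrite mulmxBr mulmx1 mulmxDl mul1mx NN addr0 addrK.
  have h'h : h' *m h = 1%:M.
    by rewrite mulmxDr mulmx1 mulmxBl mul1mx NN subr0 subrK.
  have [uh _] := mulmx1_unit hh'.
  rewrite /S (reindex (fun x => x *m h)) /=; last first.
    by exists (fun x => x *m h') => x _; rewrite -mulmxA ?hh' ?h'h mulmx1.
  apply: eq_big => [x|x]; first by rewrite unitmx_mul uh andbT.
  rewrite unitmx_mul uh andbT => ux; rewrite /f -chiD; congr chi.
  have -> : invmx (x *m h) = h' *m invmx x.
    have uxh : x *m h \in unitmx by rewrite unitmx_mul ux.
    apply: (can_inj (mulKmx uxh)); rewrite mulmxV // -mulmxA (mulmxA h) hh'.
    by rewrite mul1mx mulmxV.
  rewrite /h /h' mulmxDr mulmx1 mulmxBl mul1mx mulmxDr mulmxBr.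
  rewrite addrACA [LHS]mxtraceD; congr (_ + _).
  rewrite /w -mulmxA mulmxBl -trace_mx11 !raddfB /=; congr (_ - _).
    by rewrite /N !mulmxA mxtrace_mulC !mulmxA.
  by rewrite /N !mulmxA mxtrace_mulC !mulmxA mxtrace_mulC !mulmxA.
have q0 : (0 < #|{: 'cV[F]_n}|%:R :> C).
  by rewrite ltr0n; apply/card_gt0P; exists 0.
rewrite -(ler_pM2l q0) -[X in X * _]normr_nat -normrM.
have -> : #|{: 'cV[F]_n}|%:R * S =
    \sum_(x in unitmx) f x * \sum_(u : 'cV[F]_n) chi ((w x *m K *m u) 0 0).
  transitivity (\sum_(u : 'cV[F]_n) S); first by rewrite sumr_const mulr_natl.
  rewrite (eq_bigr _ (fun u _ => shift u)) exchange_big /=.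
  by apply: eq_bigr => x _; rewrite mulr_sumr.
apply: le_trans (ler_norm_sum _ _ _) _.
rewrite -sum1_card natr_sum mulr_sumr.
rewrite [leRHS](eq_bigl (fun x => (x \in unitmx) && (w x <= l)%MS)); last first.
  by move=> x; rewrite inE.
rewrite big_mkcondr /=; apply: ler_sum => x _.
case: ifPn => [_|wx].
  rewrite normrM chi1 mul1r mulr1 -sum1_card natr_sum.
  apply: le_trans (ler_norm_sum _ _ _) _.
  by apply: ler_sum => u _; rewrite chi1.
by rewrite (sum_char_rV chiD chiN) ?mulr0 ?normr0 // -wK.
Qed.

(** * The additive character *)

Section AdditiveCharacter.

Variables (R : realType) (F : finFieldType) (p : nat).
Hypothesis charFp : p \in [pchar F].

Local Notation L := (pPrimeCharType charFp).

Definition expi_frac (m : nat) : R[i] :=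
  cexp (Complex 0 (2 * pi * m%:R / p%:R)).

Lemma pcharF_gt0 : (0 < p)%N.
Proof. by case/andP: charFp => /prime_gt0. Qed.

Lemma expi_frac_cos_sin m : expi_frac m =
  Complex (cos (2 * pi * m%:R / p%:R)) (sin (2 * pi * m%:R / p%:R)).
Proof. by rewrite /expi_frac /cexp /= expR0 !mul1r. Qed.

Lemma expi_fracD m1 m2 : expi_frac (m1 + m2) = expi_frac m1 * expi_frac m2.
Proof.
rewrite !expi_frac_cos_sin natrD mulrDr mulrDl cosD sinD.
by rewrite /GRing.mul /=; congr Complex; rewrite addrC.
Qed.

Lemma expi_frac_period : expi_frac p = 1.
Proof.
rewrite expi_frac_cos_sin mulfK ?pnatr_eq0 -?lt0n ?pcharF_gt0 //.
by rewrite mulr_natl cos2pi sin2pi.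
Qed.

(** This lets addition in ['F_p], which is computed on representatives modulo
[p], be turned into multiplication. *)
Lemma expi_frac_modn m : expi_frac (m %% p) = expi_frac m.
Proof.
rewrite {2}(divn_eq m p) expi_fracD; suff -> k : expi_frac (k * p) = 1.
  by rewrite mul1r.
elim: k => [|k IHk]; last by rewrite mulSn expi_fracD expi_frac_period mul1r.
by rewrite expi_frac_cos_sin mulr0 mul0r cos0 sin0.
Qed.

Lemma norm_expi_frac m : `|expi_frac m| = 1.
Proof.
by rewrite expi_frac_cos_sin /Num.norm /= cos2Dsin2 sqrtr1.
Qed.

(** By the double angle formula the real part is [1 - 2 (sin t)^2] with
[t = pi m / p] strictly between [0] and [pi], so that [sin t] is positive. *)
Lemma expi_frac_neq1 m : (0 < m < p)%N -> expi_frac m != 1.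
Proof.
case/andP=> m0 mp; rewrite expi_frac_cos_sin eq_complex /= negb_and.
apply/orP; left; set t : R := pi * (m%:R / p%:R).
have p0 : 0 < p%:R :> R by rewrite ltr0n pcharF_gt0.
have sint : 0 < sin t.
  apply: sin_gt0_pi; rewrite mulr_gt0 ?pi_gt0 ?divr_gt0 ?ltr0n ?pcharF_gt0 //=.
  by rewrite -[ltRHS]mulr1 ltr_pM2l ?pi_gt0 // ltr_pdivrMr // mul1r ltr_nat.
rewrite -!mulrA mulr_natl cos_mulr2n cos2sin2 mulrnBl addrAC [1 *+ 2]mulr2n.
rewrite addrK -subr_eq0 addrAC subrr sub0r oppr_eq0 mulrn_eq0 expf_eq0.
by rewrite (gt_eqF sint).
Qed.

Lemma trFpD x y : trFp charFp (x + y) = trFp charFp x + trFp charFp y.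
Proof.
apply: (fmorph_inj (in_alg L)); rewrite rmorphD /= !trFpP.
exact: raddfD.
Qed.

(** The trace is a sum of distinct automorphisms, which are linearly independent
by the theorem of Dedekind. *)
Lemma trFp_nontrivial : exists x, trFp charFp x != 0.
Proof.
have [] := @gal_independent_contra _ L {:L}%AS
  [in 'Gal({:L} / 1)%g] (fun=> 1) _ (group1 _) (oner_neq0 _).
move=> x _ trx; exists x; apply: contraNneq trx => trx0.
have := trFpP charFp x; rewrite trx0 scale0r => /esym tr0.
by apply/eqP; rewrite -[RHS]tr0; apply: eq_bigr => s _; rewrite mul1r.
Qed.

Lemma addcharE x : addchar R charFp x = expi_frac (trFp charFp x).
Proof. by []. Qed.

Lemma addcharD : {morph addchar R charFp : x y / x + y >-> x * y}.
Proof.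
move=> x y; rewrite !addcharE trFpD -expi_fracD -[RHS]expi_frac_modn /=.
by congr (expi_frac (_ %% _)); apply: Fp_cast; case/andP: charFp.
Qed.

Lemma norm_addchar x : `|addchar R charFp x| = 1.
Proof. exact: norm_expi_frac. Qed.

Lemma addchar_nontrivial : exists t, addchar R charFp t != 1.
Proof.
have [x trx] := trFp_nontrivial; exists x; rewrite addcharE.
apply: expi_frac_neq1; rewrite lt0n trx /=.
have p_pr : prime p by case/andP: charFp.
by rewrite -[ltnRHS](Fp_cast p_pr) ltn_ord.
Qed.

Lemma kloosterman_sym n (a b : 'M[F]_n) :
  kloosterman R charFp a b = kloosterman R charFp b a.
Proof.
rewrite /kloosterman (reindex_inj (can_inj (@invmxK _ n))) /=.
by apply: eq_big => x; rewrite unitmx_inv // => _; rewrite invmxK addrC.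
Qed.

End AdditiveCharacter.

(** * The bound *)

Theorem corollary1p11 (R : realType) (F : finFieldType) (p : nat)
    (charFp : p \in [pchar F]) (n : nat) (a b : 'M[F]_n)
    (hab : ~ (a = 0 /\ b = 0)) :
  `|kloosterman R charFp a b| <= 2 * (#|F|%:R) ^+ (n ^ 2 - n + 1).
Proof.
wlog a0 : a b hab / a != 0.
  move=> bound; have [a0|/bound] := eqVneq a 0; last exact.
  rewrite kloosterman_sym; apply: bound; first by case=> b0 _; apply: hab.
  by apply/eqP => b0; apply: hab.
have [l la0] : exists l : 'rV_n, l *m a != 0.
  by have /rowV0Pn[v /submxP[l ->] la0] : a != 0 := a0; exists l.
apply: le_trans (norm_sum_unitmx_le a b l (addcharD R charFp)
  (@norm_addchar R F p charFp) (addchar_nontrivial R charFp)) _.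
rewrite -natrX -natrM ler_nat; exact: card_resonant_le.
Qed.
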